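(* Let $r\ge 1$ be an integer and let $x\ge 1$ be real. The generating functions of the sequence $(V_k^r(x))_{k\ge 0}$ are given symbolically by $$\sum_{k=0}^{\infty}\frac{u^k}{k!}V_k^r(x)=\frac1{2u}\left(e^{(2X+1)u}-e^{(2X-1)u}\right)$$ and $$\sum_{k=0}^{\infty}u^{k+1}V_k^r(x)=\frac12\log \frac{1-(2X-1)u}{1-(2X+1)u},$$ as identities of formal power series in $u$, where after expanding each right-hand side as a formal power series in $u$ whose coefficients are polynomials in the symbol $X$, each power $X^k$ with $k\ge 1$ stands for $k\sum_{n\le x}J_{k-1}^r(n)$, and $X^0$ is assigned the value $0$.
   Context: For a fixed integer $r\ge 1$ and integers $x_1,\ldots,x_k$, not all zero, $(x_1,\ldots,x_k)_r$ denotes the largest positive integer $n$ such that $n^r$ divides every $x_i$. Thus $(x_1,\ldots,x_k)_r=1$ means that there is no prime $p$ such that $p^r$ divides all of $x_1,\ldots,x_k$. The zero tuple does not satisfy $(x_1,\ldots,x_k)_r=1$. For $k\ge 1$, $V_k^r(x)$ denotes the number of $k$-tuples of integers $(x_1,\ldots,x_k)$ with $(x_1,\ldots,x_k)_r=1$ and $|x_i|\le x$ for all $i=1,\ldots,k$. For $k=0$, $V_0^r(x)=0$. General Jordan totient function: for integers $r\ge 1$, $k\ge 1$, $n\ge 1$, $$J_k^r(n)=\left|\{(x_1,\ldots,x_k)\in\mathbb{Z}^k : (x_1,\ldots,x_k,n)_r=1,\ 1\le x_i\le n\ (1\le i\le k)\}\right|,$$ and for $k=0$, $J_0^r(n)=1$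 if $n$ is $r$-free (not divisible by $p^r$ for any prime $p$) and $J_0^r(n)=0$ otherwise. The sum $\sum_{n\le x}$ is over positive integers $n\le x$. *)

(* Defs.v *)
From mathcomp Require Import all_boot all_order all_algebra finmap.
From mathcomp Require Import all_classical all_reals.

Set Implicit Arguments.
Unset Strict Implicit.
Unset Printing Implicit Defensive.

Import Order.TTheory GRing.Theory Num.Theory.
Local Open Scope classical_set_scope.
Local Open Scope ring_scope.

(* [is_rgcd r s g] is (x_1, ..., x_k)_r = g for s = [:: x_1; ...; x_k].  If all
   entries of s are 0 (in particular if s is empty), it holds for no g. *)
Definition is_rgcd (r : nat) (s : seq int) (g : nat) : Prop :=
  let pow_divides (n : nat) := {in s, forall y, ((n ^ r)%N%:Z %| y)%Z} in
  [/\ (0 < g)%N, pow_divides g &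
      forall n : nat, (0 < n)%N -> pow_divides n -> (n <= g)%N].

Definition V_tuples (R : realType) (r k : nat) (x : R) :
    set (k.-tuple int) :=
  [set t : k.-tuple int |
     is_rgcd r t 1 /\ {in tval t, forall y : int, `|y|%:~R <= x}].

Definition J_tuples (r k n : nat) : set (k.-tuple int) :=
  [set t : k.-tuple int |
     is_rgcd r (rcons t n%:Z) 1 /\
     {in tval t, forall y : int, 1 <= y <= n%:Z}].

Arguments V_tuples {R} r k x.
Arguments J_tuples : clear implicits.

Lemma finite_bounded_tuples (k N : nat) :
  finite_set [set t : k.-tuple int | {in tval t, forall y : int, `|y| <= N%:Z}].
Proof.
pose f (s : k.-tuple 'I_(N + N).+1) : k.-tuple int :=
  [tuple of map (fun i : 'I_(N + N).+1 => (i : nat)%:Z - N%:Z) s].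
apply: (@sub_finite_set _ _ (f @` setT)); last exact: finite_image.
move=> t /= tN.
exists [tuple of map (fun y : int => inord (absz (y + N%:Z))) t] => //.
apply: val_inj; rewrite /= -map_comp -[RHS]map_id.
apply/eq_in_map => y /tN; rewrite ler_norml => /andP[lo hi] /=.
have y0 : 0 <= y + N%:Z by rewrite -lerBlDr sub0r.
rewrite inordK; first by rewrite gez0_abs // addrK.
by rewrite ltnS -lez_nat gez0_abs // PoszD lerD2r.
Qed.

(* [fset_set] is a junk value on infinite sets; this lemma and the next one
   exclude that case. *)
Lemma finite_V_tuples (R : realType) (r k : nat) (x : R) :
  finite_set (V_tuples r k x).
Proof.
apply: sub_finite_set (finite_bounded_tuples k (Num.truncn x)) => t [_ tx] y /tx.
rewrite -abszE -pmulrn => yx.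
by rewrite lez_nat truncn_ge_nat // (le_trans _ yx).
Qed.

Lemma finite_J_tuples (r k n : nat) : finite_set (J_tuples r k n).
Proof.
apply: sub_finite_set (finite_bounded_tuples k n) => t [_ tn] y /tn /andP[y1 yn].
by rewrite ger0_norm // (le_trans _ y1).
Qed.

Definition V (R : realType) (r k : nat) (x : R) : nat :=
  if k == 0%N then 0%N else #|` fset_set (V_tuples r k x)|%fset.

Definition J (r k n : nat) : nat :=
  if k == 0%N then
    if `[< exists2 p, prime p & (p ^ r %| n)%N >] then 0%N else 1%N
  else #|` fset_set (J_tuples r k n)|%fset.

Definition fps (A : Type) := nat -> A.

Section FormalPowerSeries.
Variable A : comAlgType rat.
Implicit Types (f g : fps A) (c : A).

Definition fps_one : fps A := fun n => (n == 0%N)%:R.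

(* the series c u *)
Definition fps_lin c : fps A := fun n => if n == 1%N then c else 0.

Definition fps_mul f g : fps A := fun n => \sum_(i < n.+1) f i * g (n - i)%N.

Definition fps_pow f (k : nat) : fps A := iter k (fps_mul f) fps_one.

(* The composite sum_k a_k f^k, meaningful when f 0 = 0: then f^k has no term
   of degree less than k, so that only k <= n contribute in degree n. *)
Definition fps_comp (a : fps rat) f : fps A :=
  fun n => \sum_(k < n.+1) a k *: fps_pow f k n.

(* meaningful when f 0 = 0 *)
Definition fps_exp f : fps A := fps_comp (fun k => k`!%:R^-1) f.

(* log (1 + (f - 1)), meaningful when f 0 = 1; the coefficient for k = 0 is 0
   because 0^-1 = 0 in rat *)
Definition fps_log f : fps A :=
  fps_comp (fun k => (-1) ^+ k.+1 / k%:R) (f \- fps_one).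

(* 1 / (1 - (1 - f)), meaningful when f 0 = 1 *)
Definition fps_inv f : fps A := fps_comp (fun=> 1) (fps_one \- f).

Definition fps_div f g : fps A := fps_mul f (fps_inv g).

(* division by u, meaningful when f 0 = 0 *)
Definition fps_divu f : fps A := fun n => f n.+1.

End FormalPowerSeries.

Section Umbra.
Variables (R : realType) (r : nat) (x : R).

(* the value assigned to X^k *)
Definition umbral_moment (k : nat) : rat :=
  if k is k'.+1 then
    k%:R * (\sum_(1 <= n < (Num.truncn x).+1) J r k' n)%:R
  else 0.

Definition umbral (p : {poly rat}) : rat :=
  \sum_(i < size p) p`_i * umbral_moment i.

Definition umbral_fps (f : fps {poly rat}) : fps rat := fun n => umbral (f n).

End Umbra.

(* Main.v *)
(** Modulo n, the integers of absolute value at most n form two copies of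
    {1, ..., n} together with one extra 0, and those of absolute value at most
    n - 1 form two copies of {1, ..., n} with one 0 removed.  A tuple of maximum
    norm n satisfies (x_1, ..., x_k)_r = 1 iff (x_1, ..., x_k, n)_r = 1, and the
    latter condition is n-periodic in each entry and ignores zero entries.
    Expanding (2 P + 0)^k - (2 P - 0)^k binomially, where P^j stands for
    J_j(n), gives
      V_k(x) = sum_j C(k, j) 2^j (1 - (-1)^(k - j)) sum_(n <= x) J_j(n),
    which is the umbral value of ((2X + 1)^(k + 1) - (2X - 1)^(k + 1)) /
    (2 (k + 1)).  These are the coefficients of both series; for the logarithm
    one uses (1 - b u) / (1 - a u) = 1 + (a - b) u / (1 - a u) and the
    expansion of b^n = (a - (a - b))^n. *)
Require Import Defs.
From mathcomp Require Import all_boot all_order all_algebra finmap.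
From mathcomp Require Import all_classical all_reals.
From mathcomp Require Import ring zify.
Import Order.TTheory GRing.Theory Num.Theory.
Local Open Scope ring_scope.

(** * Sums over words and their binomial expansion *)

Section Words.
Variable T : eqType.
Implicit Types (L M : seq T) (w : seq T).

Fixpoint words L k : seq (seq T) :=
  if k is k'.+1 then [seq y :: w | y <- L, w <- words L k'] else [:: [::]].

Lemma mem_words L k w : (w \in words L k) = (size w == k) && all [in L] w.
Proof.
elim: k w => [|k IHk] [|y w] //=.
  by apply/allpairsP => -[[z v] [_ _]].
rewrite eqSS; apply/allpairsP/idP => [[[z v] /= [zL vk [-> ->]]]|].
  by move: vk; rewrite IHk zL => /andP[-> ->].
by move=> /and3P[wk yL wL]; exists (y, w); split; rewrite //= IHk wk.
Qed.

Lemma words_uniq L k : uniq L -> uniq (words L k).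
Proof.
move=> uL; elim: k => //= k IHk.
by apply: allpairs_uniq => // -[y w] [z v] _ _ [-> ->].
Qed.

Lemma sum_wordsS (A : nmodType) L k (f : seq T -> A) :
  \sum_(w <- words L k.+1) f w = \sum_(w <- words L k) \sum_(y <- L) f (y :: w).
Proof. by rewrite /= big_allpairs_dep exchange_big. Qed.

(** Letters are exchanged one position at a time; the arbitrary [s] and [t] let the induction absorb
    a letter into [f]. *)
Lemma eq_sum_words (A : nmodType) L M (f : seq T -> A) :
  (forall s t, \sum_(y <- L) f (s ++ y :: t) = \sum_(y <- M) f (s ++ y :: t)) ->
  forall k, \sum_(w <- words L k) f w = \sum_(w <- words M k) f w.
Proof.
move=> LM k; elim: k f LM => [|k IHk] f LM; first by [].
rewrite !sum_wordsS; under eq_bigr => w _ do rewrite (LM [::] w).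
apply: (IHk (fun w => \sum_(y <- M) f (y :: w))) => s t.
rewrite exchange_big [RHS]exchange_big; apply: eq_bigr => y _.
exact: (LM (y :: s)).
Qed.

(** Each position filled from [L] acts as [c] times a letter of [M] plus [e] times an erased
    position; after expansion over all positions, [j] counts those kept. *)
Lemma sum_words_binomial (A : comPzRingType) L M (c e : A) (f : seq T -> A) :
  (forall s t, \sum_(y <- L) f (s ++ y :: t) =
     c * \sum_(y <- M) f (s ++ y :: t) + e * f (s ++ t)) ->
  forall k, \sum_(w <- words L k) f w =
    \sum_(j < k.+1) (c ^+ j * e ^+ (k - j) * \sum_(w <- words M j) f w)
      *+ 'C(k, j).
Proof.
move=> LM k; elim: k f LM => [|k IHk] f LM.
  by rewrite big_ord1 !expr0 !mul1r mulr1n.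
pose F j := \sum_(w <- words M j) f w.
have -> : \sum_(w <- words L k.+1) f w =
    c * (\sum_(y <- M) \sum_(w <- words L k) f (y :: w)) +
    e * \sum_(w <- words L k) f w.
  rewrite sum_wordsS; under eq_bigr => w _ do rewrite (LM [::] w).
  by rewrite big_split /= -!mulr_sumr exchange_big.
have -> : \sum_(w <- words L k) f w =
    \sum_(j < k.+1) (c ^+ j * e ^+ (k - j) * F j) *+ 'C(k, j) by exact: IHk.
under eq_bigr => y _ do rewrite (IHk _ (fun s => LM (y :: s))).
rewrite exchange_big /=.
under eq_bigr => j _ do rewrite sumrMnl -mulr_sumr -big_allpairs_dep -/(F j.+1).
rewrite -[RHS]/(\sum_(j < k.+2)
  (c ^+ j * e ^+ (k.+1 - j) * F j) *+ 'C(k.+1, j)).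
rewrite [RHS]big_ord_recl bin0 mulr1n expr0 mul1r subn0.
(* Pascal's rule separates the terms whose first position is erased from those whose first position
   is kept. *)
under [in RHS]eq_bigr => j _ do rewrite lift0 subSS binS mulrnDr.
rewrite big_split /= addrA [LHS]addrC !mulr_sumr; congr (_ + _); last first.
  by apply: eq_bigr => j _; rewrite mulrnAr exprS !mulrA.
rewrite [in RHS]big_ord_recr /= bin_small // mulr0n addr0.
rewrite big_ord_recl /= bin0 mulr1n expr0 mul1r subn0 exprS mulrA.
congr (_ + _); first by rewrite -mulr_sumr.
apply: eq_bigr => j _.
rewrite /bump leq0n add1n -(subnSK (ltn_ord j)) mulrnAr !exprS.
by congr (_ *+ _); ring.
Qed.

End Words.

Arguments words {T} L k.

(** * Coefficients of the exponential and logarithmic series *)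

Section FpsCoefficients.
Variable A : comAlgType rat.
Implicit Types (f : fps A) (a b c : A).

Lemma fps_pow_lin a k n :
  fps_pow (fps_lin a) k n = if n == k then a ^+ k else 0.
Proof.
elim: k n => [|k IHk] n; first by rewrite /= /fps_one expr0; case: eqP.
rewrite /fps_pow iterS -/(fps_pow _ k) /fps_mul.
case: n => [|n]; first by rewrite big_ord1 /fps_lin mul0r.
rewrite big_ord_recl /= /fps_lin mul0r add0r big_ord_recl /=.
rewrite subSS subn0 IHk eqSS big1 ?addr0 => [|i _]; last by rewrite mul0r.
by case: eqP => _; rewrite ?exprS ?mulr0.
Qed.

Lemma fps_comp_lin (s : fps rat) a n : fps_comp s (fps_lin a) n = s n *: a ^+ n.
Proof.
rewrite /fps_comp big_ord_recr /= fps_pow_lin eqxx big1 ?add0r // => i _.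
by rewrite fps_pow_lin gtn_eqF ?scaler0.
Qed.

(** Here f = c u / (1 - a u), so its powers are given by the negative binomial series. *)
Lemma fps_pow_geometric f a c :
  f 0%N = 0 -> (forall n, f n.+1 = c * a ^+ n) ->
  forall k n, fps_pow f k.+1 n =
    if n is n'.+1 then (c ^+ k.+1 * a ^+ (n' - k)) *+ 'C(n', k) else 0.
Proof.
move=> f0 fS.
have mul0 g : fps_mul f g 0%N = 0 by rewrite /fps_mul big_ord1 f0 mul0r.
(* This is (1 - a u) f g = c u g read off in degree n + 1; it drives the induction on the degree. *)
have mulS g n : fps_mul f g n.+1 = a * fps_mul f g n + c * g n.
  rewrite /fps_mul big_ord_recl /= f0 mul0r add0r [in RHS]big_ord_recl /=.
  rewrite f0 mul0r add0r big_ord_recl /= fS subSS subn0 expr0 mulr1 addrC.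
  congr (_ + _); rewrite mulr_sumr; apply: eq_bigr => i _.
  by rewrite /bump /= !add1n subSS !fS exprS; ring.
have powS k : fps_pow f k.+1 = fps_mul f (fps_pow f k) by [].
move=> k n; elim: n k => [|n IHn] k; rewrite powS ?mul0 // mulS -powS IHn.
case: k => [|k].
  case: n {IHn} => [|n]; rewrite /= /fps_one /= !bin0 !mulr1n ?subn0.
    by rewrite mulr0 add0r expr0 expr1.
  by rewrite mulr0 addr0 expr1 exprS mulrCA.
rewrite IHn; case: n {IHn} => [|n]; first by rewrite bin_small // mulr0n; ring.
rewrite binS mulrnDr subSS; congr (_ + _); last first.
  by rewrite mulrnAr mulrA -exprS.
have [kn|nk] := leqP k.+1 n; last by rewrite bin_small // !mulr0n mulr0.
by rewrite -(subnSK kn) (exprS a) mulrnAr mulrCA.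
Qed.

(** These are the coefficients of log (1 - b u) - log (1 - a u), found directly from the powers of
    the argument. *)
Lemma fps_log_div a b n :
  fps_log (fps_div (fps_one A \- fps_lin b) (fps_one A \- fps_lin a)) n =
  n%:R^-1 *: (a ^+ n - b ^+ n).
Proof.
have inv_geom : fps_inv (fps_one A \- fps_lin a) = (fun m => a ^+ m).
  apply/funext => m; rewrite /fps_inv.
  rewrite (_ : fps_one A \- _ = fps_lin a).
    by rewrite fps_comp_lin scale1r.
  by apply/funext => i /=; rewrite subKr.
rewrite /fps_log /fps_div inv_geom.
set f := (_ \- fps_one A).
have f0 : f 0%N = 0.
  by rewrite /f /fps_mul /= big_ord1 /fps_one /fps_lin /=; ring.
have fS m : f m.+1 = (a - b) * a ^+ m.
  rewrite /f /fps_mul /= big_ord_recl /= big_ord_recl /= big1 => [|i _].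
    by rewrite /fps_one /fps_lin /= subn0 subSS subn0 exprS; ring.
  by rewrite /fps_one /fps_lin /=; ring.
case: n => [|n]; rewrite /fps_comp.
  by rewrite big_ord1 !expr0 subrr scaler0 invr0 mulr0 scale0r.
set P := fps_pow f; rewrite big_ord_recl invr0 mulr0 scale0r add0r.
(* Expanding around [a] cancels [a ^+ n.+1] and leaves one term for each positive power of [f]. *)
have -> : b ^+ n.+1 = (a + - (a - b)) ^+ n.+1 by congr (_ ^+ _); ring.
rewrite [in RHS]exprDn [in RHS]big_ord_recl bin0 subn0
  expr0 mulr1 mulr1n opprD addNKr.
rewrite -sumrN scaler_sumr; apply: eq_bigr => i _.
rewrite lift0 /P (fps_pow_geometric _ a (a - b)) // subSS.
rewrite [(- (a - b)) ^+ _]exprNn.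
rewrite -!scaler_nat scalerA.
have -> : - ('C(n.+1, i.+1)%:R *:
   (a ^+ (n - i) * ((-1) ^+ i.+1 * (a - b) ^+ i.+1)) : A) =
   ('C(n.+1, i.+1)%:R * (-1) ^+ i.+2 : rat) *: ((a - b) ^+ i.+1 * a ^+ (n - i)).
  rewrite -scalerA -scalerN; congr (_ *: _).
  rewrite -signr_odd -[in RHS]signr_odd /=; case: (odd i) => /=;
   rewrite ?expr0 ?expr1 ?scaleNr ?scale1r; ring.
rewrite scalerA; congr (_ *: _).
(* Absorption turns the weight 1/(i + 1) of the logarithm into the common factor 1/(n + 1). *)
have := mul_bin_diag n.+1 i => /(congr1 (fun m => m%:R : rat)).
rewrite !natrM => h.
have i0 : i.+1%:R != 0 :> rat by rewrite pnatr_eq0.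
have n0 : n.+1%:R != 0 :> rat by rewrite pnatr_eq0.
move: h i0 n0; move: n.+1%:R i.+1%:R 'C(n, i)%:R 'C(n.+1, i.+1)%:R.
move=> N I C D h i0 n0.
have -> : C = N^-1 * (I * D) by rewrite -h mulKf.
by field; rewrite n0 i0.
Qed.

End FpsCoefficients.

(** * From cardinals of sets of tuples to sums of indicators over words *)

Lemma card_fset_set_words (k : nat) (L : seq int) (P : seq int -> Prop)
    (A : set (k.-tuple int)) : uniq L -> finite_set A ->
    (forall t : k.-tuple int, A t <-> P t /\ all [in L] t) ->
  (#|` fset_set A|%fset)%:R = \sum_(w <- words L k) `[< P w >]%:R :> rat.
Proof.
move=> uL finA AP.
have -> : \sum_(w <- words L k) `[< P w >]%:R =
    (size [seq w <- words L k | `[< P w >]])%:R :> rat.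
  rewrite -natr_sum size_filter -sum1_count [in RHS]big_mkcond /=.
  by congr (_%:R); apply: eq_bigr => w _; case: `[< P w >].
rewrite -(size_map val); congr (_%:R).
apply/perm_size/uniq_perm.
- by rewrite map_inj_uniq ?fset_uniq //; exact: val_inj.
- exact/filter_uniq/words_uniq.
move=> w; rewrite mem_filter mem_words; apply/mapP/idP => [[t]|].
  rewrite in_fset_set // inE => /AP[Pt tL] ->.
  by rewrite size_tuple eqxx tL !andbT; exact/asboolP.
case/and3P => /asboolP Pw wk wL; exists (Tuple wk) => //.
by rewrite in_fset_set // inE; apply/AP.
Qed.

(** * Invariance properties of the condition (x_1, ..., x_k)_r = 1 *)

Section Rgcd.
Variable r : nat.
Implicit Types (s t : seq int) (y z : int) (n : nat).

Definition rgcd1 s : bool := `[< is_rgcd r s 1 >].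

Lemma rgcd1P s :
  reflect (forall m : nat,
             (0 < m)%N -> all [in dvdz (m ^ r)%N] s -> (m <= 1)%N)
          (rgcd1 s).
Proof.
rewrite /rgcd1; apply: (iffP (asboolP _)) => [[_ _ s1] m m0 /allP|s1].
  exact: s1.
split=> // [y _|m m0 /allP]; last exact: s1.
by rewrite exp1n dvd1z.
Qed.

Lemma eq_rgcd1 s t :
  (forall d : nat, all [in dvdz d] s = all [in dvdz d] t) -> rgcd1 s = rgcd1 t.
Proof.
move=> st; apply/rgcd1P/rgcd1P => H m m0 ms; apply: (H m m0);
  by rewrite ?st // -st.
Qed.

Lemma rgcd1_rcons_eqmod n s t y z : (n %| y - z)%Z ->
  rgcd1 (rcons (s ++ y :: t) n) = rgcd1 (rcons (s ++ z :: t) n).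
Proof.
move=> yz; apply: eq_rgcd1 => d; rewrite !all_rcons !all_cat /=.
case dn : (n%:Z \in dvdz d) => //=.
by rewrite -(subrK z y) rpredDl ?(dvdz_trans dn yz).
Qed.

Lemma rgcd1_rcons0 n s t :
  rgcd1 (rcons (s ++ 0 :: t) n) = rgcd1 (rcons (s ++ t) n).
Proof. by apply: eq_rgcd1 => d; rewrite !all_rcons !all_cat /= dvdz0. Qed.

(** Appending n changes nothing for a word that already contains n or -n. *)
Lemma rgcd1_rcons_abs y s t :
  rgcd1 (rcons (s ++ y :: t) `|y|%N) = rgcd1 (s ++ y :: t).
Proof.
apply: eq_rgcd1 => d; rewrite !all_rcons !all_cat /= !dvdzE absz_nat.
by case: (_ %| _)%N; rewrite ?andbF.
Qed.

End Rgcd.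

(** * Intervals of integers and periodic sums over them *)

Definition int_range n : seq int := [seq i%:Z | i <- index_iota 1 n.+1].

(** Each unit of radius adds two letters at the head, so that induction on the radius is a plain
    [big_cons]. *)
Fixpoint int_ball n : seq int :=
  if n is n'.+1 then n%:Z :: - n%:Z :: int_ball n' else [:: 0].

Lemma mem_int_range n y : (y \in int_range n) = (1 <= y <= n%:Z).
Proof.
apply/mapP/idP => [[i]|]; first by rewrite mem_index_iota => ? ->; lia.
by move=> yn; exists `|y|%N; rewrite ?mem_index_iota; lia.
Qed.

Lemma mem_int_ball n y : (y \in int_ball n) = (`|y| <= n%:Z).
Proof.
elim: n => [|n IHn] /=; first by rewrite inE; lia.
by rewrite !inE IHn; lia.
Qed.

Lemma int_range_uniq n : uniq (int_range n).
Proof. by rewrite map_inj_uniq ?iota_uniq // => i j []. Qed.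

Lemma int_ball_uniq n : uniq (int_ball n).
Proof.
elim: n => //= n IHn; rewrite !inE !mem_int_ball IHn andbT; lia.
Qed.

Lemma sum_int_ball (A : nmodType) n (f : int -> A) :
  \sum_(y <- int_ball n) f y =
    f 0 + \sum_(1 <= i < n.+1) (f i%:Z + f (- i%:Z)).
Proof.
elim: n => [|n IHn]; first by rewrite big_seq1 big_geq // addr0.
by rewrite big_nat_recr //= !big_cons IHn addrA [LHS]addrC -addrA.
Qed.

Lemma sum_int_ball_periodic (A : comPzRingType) n (f : int -> A) :
  (forall y z, (n.+1%:Z %| y - z)%Z -> f y = f z) ->
  \sum_(y <- int_ball n.+1) f y =
    2%:R * \sum_(y <- int_range n.+1) f y + 1 * f 0
  /\
  \sum_(y <- int_ball n) f y =
    2%:R * \sum_(y <- int_range n.+1) f y + -1 * f 0.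
Proof.
move=> fper.
have fn : f n.+1%:Z = f 0 by apply: fper; rewrite subr0 dvdzz.
have fNn : f (- n.+1%:Z) = f 0 by apply: fper; rewrite subr0 dvdzE abszN.
have ball : \sum_(y <- int_ball n.+1) f y =
    2%:R * \sum_(y <- int_range n.+1) f y + 1 * f 0.
  rewrite sum_int_ball big_split /= addrC mul1r; congr (_ + _).
  rewrite mulr_natl mulr2n big_map; congr (_ + _).
  (* Reversal pairs -(n + 1 - i) with i, congruent modulo n + 1; the leftover endpoints n + 1 and
     -(n + 1) are both congruent to 0. *)
  rewrite big_nat_rev /= [RHS]big_nat_recr //= fn.
  rewrite [LHS]big_nat_recl //= addrC; congr (_ + _); last first.
    by rewrite -fNn; congr f; lia.
  rewrite [LHS]big_nat_cond [RHS]big_nat_cond; apply: eq_bigr => i.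
  rewrite andbT => ni; apply: fper.
  rewrite (_ : _ - _ = - n.+1%:Z) ?dvdzE ?abszN //; lia.
split=> //; move: ball; rewrite /= !big_cons fn fNn.
set S := \sum_(_ <- _) _ => ball.
have -> : S = f 0 + (f 0 + S) - f 0 - f 0 by ring.
by rewrite ball; ring.
Qed.

(** * Counting by maximum norm *)

Section Counting.
Variable r : nat.
Implicit Types k n : nat.

Lemma J_sum k n : (0 < n)%N ->
  (J r k n)%:R =
    \sum_(w <- words (int_range n) k) (rgcd1 r (rcons w n))%:R :> rat.
Proof.
move=> n0; rewrite /J; case: eqP => [->|_]; last first.
  apply: card_fset_set_words (int_range_uniq n) (finite_J_tuples r k n) _ => t.
  split=> -[tr tn]; split=> //.
    by apply/allP => y /tn; rewrite mem_int_range.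
  by move=> y /(allP tn); rewrite mem_int_range.
(* For k = 0 only the empty word remains and the condition says that n is r-free; a bad m > 1 yields
   the bad prime [pdiv m]. *)
rewrite /= big_seq1 /=; congr (_%:R).
case: ifPn => [/asboolP[p pp pn]|/asboolPn np]; apply/esym/eqP.
  rewrite eqb0; apply/rgcd1P => /(_ p (prime_gt0 pp)).
  rewrite /= andbT dvdzE pn.
  by move=> /(_ isT); rewrite leqNgt prime_gt1.
rewrite eqb1; apply/rgcd1P => m m0; rewrite /= andbT dvdzE /= => mn.
rewrite leqNgt; apply/negP => m1; apply: np; exists (pdiv m).
  exact: pdiv_prime.
exact: dvdn_trans (dvdn_exp2r r (pdiv_dvd m)) mn.
Qed.

Lemma V_sum k (R : realType) (x : R) : (0 < k)%N -> 0 <= x ->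
  (V r k x)%:R =
    \sum_(w <- words (int_ball (Num.truncn x)) k) (rgcd1 r w)%:R :> rat.
Proof.
move=> k0 x0; rewrite /V gtn_eqF //.
have le_trunc (y : int) : (`|y|%:~R <= x) = (`|y| <= (Num.truncn x)%:Z).
  by rewrite -abszE -pmulrn lez_nat truncn_ge_nat.
apply: card_fset_set_words (int_ball_uniq _) (finite_V_tuples r k x) _ => t.
split=> -[tr tx]; split=> //.
  by apply/allP => y /tx; rewrite le_trunc mem_int_ball.
by move=> y /(allP tx); rewrite le_trunc mem_int_ball.
Qed.

Lemma rgcd1_ball_succ k n :
  \sum_(w <- words (int_ball n.+1) k) (rgcd1 r w)%:R =
  \sum_(w <- words (int_ball n) k) (rgcd1 r w)%:R +
  \sum_(j < k.+1) (2%:R ^+ j * (1 - (-1) ^+ (k - j)) * (J r j n.+1)%:R)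
     *+ 'C(k, j) :> rat.
Proof.
pose h (w : seq int) := (rgcd1 r (rcons w n.+1))%:R : rat.
have hper s t y z : (n.+1%:Z %| y - z)%Z -> h (s ++ y :: t) = h (s ++ z :: t).
  by move=> yz; rewrite /h (rgcd1_rcons_eqmod _ _ _ _ _ _ yz).
have h0 s t : h (s ++ t) = h (s ++ 0 :: t) by rewrite /h rgcd1_rcons0.
have -> : \sum_(w <- words (int_ball n.+1) k) (rgcd1 r w)%:R =
    \sum_(w <- words (int_ball n) k) (rgcd1 r w)%:R +
    (\sum_(w <- words (int_ball n.+1) k) h w -
     \sum_(w <- words (int_ball n) k) h w).
  (* The summand vanishes on words containing n + 1 or -(n + 1), so both balls give the same sum. *)
  have : \sum_(w <- words (int_ball n.+1) k) ((rgcd1 r w)%:R - h w) =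
      \sum_(w <- words (int_ball n) k) ((rgcd1 r w)%:R - h w).
    apply: eq_sum_words => s t; rewrite /= !big_cons /h.
    rewrite -(rgcd1_rcons_abs r n.+1%:Z) -(rgcd1_rcons_abs r (- n.+1%:Z)) /=.
    by rewrite !subrr !add0r.
  by rewrite !sumrB => /eqP; rewrite subr_eq => /eqP ->; ring.
congr (_ + _).
(* The two radii differ only in e = 1 against e = -1, whence the factor 1 - (-1)^(k - j). *)
rewrite (sum_words_binomial _ _ _ (int_range n.+1) 2%:R 1 h); last first.
  by move=> s t; rewrite h0; apply: (sum_int_ball_periodic _ n _ (hper s t)).1.
rewrite (sum_words_binomial _ _ _ (int_range n.+1) 2%:R (-1) h); last first.
  by move=> s t; rewrite h0; apply: (sum_int_ball_periodic _ n _ (hper s t)).2.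
rewrite -sumrB; apply: eq_bigr => j _.
by rewrite -mulrnBl -mulrBl -mulrBr expr1n J_sum.
Qed.

End Counting.

Lemma V_binomial (R : realType) r k (x : R) : 0 <= x ->
  (V r k x)%:R =
  \sum_(j < k.+1) (2%:R ^+ j * (1 - (-1) ^+ (k - j)) *
      (\sum_(1 <= n < (Num.truncn x).+1) J r j n)%:R) *+ 'C(k, j) :> rat.
Proof.
(* For k = 0 the factor 1 - (-1)^0 vanishes, in accordance with V_0 = 0. *)
case: k => [|k] x0; first by rewrite big_ord1 subrr mulr0 mul0r.
rewrite V_sum //; elim: (Num.truncn x) => [|N IHN].
  rewrite [RHS]big1 => [|j _]; last by rewrite big_geq // mulr0 mul0rn.
  rewrite big_seq big1 // => w; rewrite mem_words => /andP[_ /allP w0].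
  (* At radius 0 only the zero word occurs, and 2 ^ r divides all its entries. *)
  case: rgcd1P => // /(_ 2 isT) H; have : (2 <= 1)%N; last by [].
  by apply/H/allP => y /w0; rewrite /= inE => /eqP ->; rewrite dvdz0.
rewrite rgcd1_ball_succ IHN -big_split /=; apply: eq_bigr => j _.
by rewrite -mulrnDl -mulrDr -natrD [in RHS]big_nat_recr.
Qed.

(** * Umbral evaluation *)

Lemma umbral_poly (R : realType) r (x : R) (c : nat -> rat) n :
  umbral r x (\poly_(i < n) c i) = \sum_(i < n) c i * umbral_moment r x i.
Proof.
rewrite /umbral; set p := \poly_(i < n) c i.
transitivity (\sum_(i < n) p`_i * umbral_moment r x i); last first.
  by apply: eq_bigr => i _; rewrite coef_poly ltn_ord.
rewrite (big_ord_widen n (fun i => p`_i * umbral_moment r x i) (size_poly _ _)).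
rewrite big_mkcond; apply: eq_bigr => i _.
by case: ltnP => // /(nth_default 0) ->; rewrite mul0r.
Qed.

Lemma exp_lin_poly (A : comNzRingType) (a b : A) n :
  (a *: 'X + b%:P) ^+ n = \poly_(i < n.+1) (a ^+ i * b ^+ (n - i) *+ 'C(n, i)).
Proof.
rewrite poly_def addrC exprDn; apply: eq_bigr => i _.
by rewrite exprZn -polyC_exp mul_polyC scalerA scalerMnl mulrC.
Qed.

(** The factor j + 1 in the moment of X^(j + 1) is absorbed by (j + 1) C(k + 1, j + 1) = (k + 1)
    C(k, j), which leaves [V_binomial]. *)
Lemma umbral_diff_pow (R : realType) r k (x : R) (c : rat) : 0 <= x ->
  umbral r x (c *: ((2%:R *: 'X + 1) ^+ k.+1 - (2%:R *: 'X - 1) ^+ k.+1)) =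
  c * 2%:R * k.+1%:R * (V r k x)%:R.
Proof.
move=> x0.
have -> : c *: ((2%:R *: 'X + 1) ^+ k.+1 - (2%:R *: 'X - 1) ^+ k.+1) =
    \poly_(i < k.+2)
      (c * (2%:R ^+ i * (1 - (-1) ^+ (k.+1 - i)) *+ 'C(k.+1, i))).
  rewrite -polyCN !exp_lin_poly !poly_def -sumrB scaler_sumr.
  apply: eq_bigr => i _; rewrite -scalerBl scalerA; congr (_ *: _).
  by rewrite expr1n -mulrnBl -mulrBr.
(* The constant term drops out since X^0 has value 0; this shifts the index by one. *)
rewrite umbral_poly big_ord_recl mulr0 add0r V_binomial // mulr_sumr.
apply: eq_bigr => j _; rewrite lift0 subSS /=.
have := mul_bin_diag k.+1 j => /(congr1 (fun m => m%:R : rat)).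
rewrite !natrM /= => h.
set S := (\sum_(_ <= _ < _) _)%:R; set e := 1 - _.
rewrite -[_ * e *+ _]mulr_natr -[_ * S *+ _]mulr_natr exprS.
transitivity (c * 2%:R * 2%:R ^+ j * e * S * (j.+1%:R * 'C(k.+1, j.+1)%:R)).
  by ring.
by rewrite -h; ring.
Qed.

Theorem theorem3p1 (R : realType) (r : nat) (x : R)
    (hr : (0 < r)%N) (hx : 1 <= x) :
  let a : {poly rat} := 2%:R *: 'X + 1 in
  let b : {poly rat} := 2%:R *: 'X - 1 in
  (forall k : nat,
      (V r k x)%:R / k`!%:R =
      umbral_fps r x
        (2%:R^-1 \*: fps_divu (fps_exp (fps_lin a) \- fps_exp (fps_lin b))) k)
  /\
  (forall n : nat,
      (if n is k.+1 then (V r k x)%:R else 0) =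
      umbral_fps r x
        (2%:R^-1 \*: fps_log (fps_div (fps_one _ \- fps_lin b)
                                      (fps_one _ \- fps_lin a))) n).
Proof.
move=> a b; have x0 : 0 <= x := le_trans ler01 hx.
split=> [k|[|k]]; rewrite /umbral_fps /=.
- rewrite /fps_divu /= /fps_exp !fps_comp_lin -scalerBr scalerA.
  (* Division by u makes the scalar 1/(2 (k + 1)!), so that 1/k! remains after multiplication by 2
     (k + 1). *)
  rewrite umbral_diff_pow // factS natrM.
  have k0 : k.+1%:R != 0 :> rat by rewrite pnatr_eq0.
  have f0 : k`!%:R != 0 :> rat by rewrite pnatr_eq0 -lt0n fact_gt0.
  by move: k.+1%:R k`!%:R k0 f0 => K F K0 F0; field; rewrite K0 F0.
- by rewrite fps_log_div !expr0 subrr !scaler0 /umbral size_poly0 big_ord0.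
rewrite fps_log_div scalerA umbral_diff_pow //.
have k0 : k.+1%:R != 0 :> rat by rewrite pnatr_eq0.
by move: k.+1%:R k0 => K K0; field.
Qed.
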